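(* Let $I$ be a quasiconcave function satisfying $\int_0^t\frac{I(s)}{s}ds\lesssim I(t)$ for $t\in(0,1)$. Let $Y$ be an r.i. space such that $H_I1\in Y$. If $T_I$ is bounded on $Y'$, then $$\sup_{h\sim f}\|H_Ih\|_Y\approx\|H_If^*\|_Y,\quad f\in\mathcal M_+(0,1).$$ In other words, for the optimal domain space, $\|f\|_{X_Y}\approx\|H_If^*\|_Y$ for $f\in\mathcal M_+(0,1)$.
   Context: Functions live on $(0,1)$; $\mathcal M_+(0,1)$ nonnegative measurable functions; $f^*$ nonincreasing rearrangement; $h\sim f$ means $h\in\mathcal M_+(0,1)$ is equimeasurable with $f$ ($h^*=f^*$). An r.i. space is a rearrangement-invariant Banach function space on $(0,1)$; $Y'$ its associate space. A quasiconcave function is a nondecreasing bijection $I:(0,1)\to(0,1)$ with $I(0+)=0$, $I(1-)=1$ and $I(t)/t$ nonincreasing. $H_If(t)=\int_t^1\frac{f(s)}{I(s)}ds$, $T_If(t)=\frac{I(t)}{t}\sup_{t\le s<1}\frac s{I(s)}f^*(s)$. $X_Y$ is the optimal domain space of $Y$ under $H_I$ ($H_I:X_Y\to Y$ bounded, and $W\hookrightarrow X_Y$ whenever $H_I:W\to Y$ is bounded for an r.i. $W$); it is known that when $H_I1\in Y$ it exists and $\|f\|_{X_Y}=\sup_{h\sim f}\|H_Ih\|_Y$. $\approx$: up to constants independent of $f$. *)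

(* Defs.v *)
(* Functions on (0,1) are represented as
   functions R -> \bar R; only their values on D := ]0,1[ matter. *)
From HB Require Import structures.
From mathcomp Require Import all_boot all_order all_algebra.
From mathcomp Require Import all_classical all_reals all_analysis measurable_realfun.
Set Implicit Arguments. Unset Strict Implicit. Unset Printing Implicit Defensive.
Import Order.TTheory GRing.Theory Num.Theory.
Import numFieldNormedType.Exports.
Local Open Scope classical_set_scope.
Local Open Scope ring_scope.
Local Open Scope ereal_scope.

Section Defs.
Variable R : realType.
Local Notation mu := (@lebesgue_measure R).

Definition D01 : set R := `]0%R, 1%R[.

Definition Mplus (f : R -> \bar R) : Prop :=
  measurable_fun D01 f /\ forall x, D01 x -> 0 <= f x.

Definition distr_fun (f : R -> \bar R) (l : R) : \bar R :=
  mu (D01 `&` [set x | l%:E < f x]).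

Definition fstar (f : R -> \bar R) (t : R) : \bar R :=
  ereal_inf [set l%:E | l in [set l : R | (0 <= l)%R /\ distr_fun f l <= t%:E]].

Definition equimeas (f h : R -> \bar R) : Prop :=
  Mplus h /\ forall t, D01 t -> fstar h t = fstar f t.

(* rho is a rearrangement-invariant Banach function norm on M_+(0,1)
   (axioms (P1)-(P5) of Bennett-Sharpley + rearrangement invariance). *)
Definition ri_norm (rho : (R -> \bar R) -> \bar R) : Prop :=
  (forall f, Mplus f -> 0 <= rho f) /\
  (forall f, Mplus f -> (rho f = 0 <-> {ae mu, forall x, D01 x -> f x = 0})) /\
  (forall f (a : R), Mplus f -> (0 <= a)%R ->
     rho (fun x => a%:E * f x) = a%:E * rho f) /\
  (forall f g, Mplus f -> Mplus g -> rho (fun x => f x + g x) <= rho f + rho g) /\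
  (forall f g, Mplus f -> Mplus g ->
     {ae mu, forall x, D01 x -> g x <= f x} -> rho g <= rho f) /\
  (forall (F : nat -> R -> \bar R) f, (forall n, Mplus (F n)) -> Mplus f ->
     (forall x, D01 x -> {homo (fun n => F n x) : n m / (n <= m)%N >-> n <= m}) ->
     (forall x, D01 x -> (fun n => F n x) @ \oo --> f x) ->
     (fun n => rho (F n)) @ \oo --> rho f) /\
  (forall E, measurable E -> E `<=` D01 -> rho (fun x => (\1_E x)%:E) < +oo) /\
  (forall E, measurable E -> E `<=` D01 -> exists C : R,
     forall f, Mplus f -> \int[mu]_(x in E) f x <= C%:E * rho f) /\
  (forall f g, Mplus f -> Mplus g ->
     (forall t, D01 t -> fstar f t = fstar g t) -> rho f = rho g).

Definition assoc_norm (rho : (R -> \bar R) -> \bar R) (g : R -> \bar R) : \bar R :=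
  ereal_sup [set \int[mu]_(x in D01) (f x * g x) |
             f in [set f | Mplus f /\ rho f <= 1]].

Definition quasiconcave (I : R -> R) : Prop :=
  (forall s t, D01 s -> D01 t -> (s <= t)%R -> (I s <= I t)%R) /\
  (forall t, D01 t -> D01 (I t)) /\
  (forall s t, D01 s -> D01 t -> I s = I t -> s = t) /\
  (forall y, D01 y -> exists2 t, D01 t & I t = y) /\
  (I x @[x --> (0%R : R)^'+] --> (0%R : R)) /\
  (I x @[x --> (1%R : R)^'-] --> (1%R : R)) /\
  (forall s t, D01 s -> D01 t -> (s <= t)%R -> (I t / t <= I s / s)%R).

Definition H_op (I : R -> R) (f : R -> \bar R) (t : R) : \bar R :=
  \int[mu]_(s in `]t, 1%R[) (f s * ((I s)^-1)%:E).

Definition T_op (I : R -> R) (f : R -> \bar R) (t : R) : \bar R :=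
  (I t / t)%:E * ereal_sup [set (s / I s)%:E * fstar f s | s in `[t, 1%R[].

End Defs.

(* Main.v *)
(* The lower bound is the choice h = f^*.  For the upper bound, test
   H_I h against g: since H_I h is nonincreasing, Hardy-Littlewood and Fubini give
     \int g H_I h <= \int g^* H_I h = \int h(s) (1/I(s)) \int_0^s g^* ds.
   The hypothesis on I shows that the least nonincreasing majorant of
   s |-> (1/I(s)) \int_0^s g^* is at most (1 + C) (1/I(s)) \int_0^s T_I g, so a
   second use of Hardy-Littlewood and Fubini yields
     \int g H_I h <= (1 + C) \int T_I g H_I h^*,
   which Hoelder's inequality and the boundedness of T_I on Y' bound by a multiple
   of ||g||_{Y'} ||H_I h^*||_Y.  It remains to use Y'' = Y.  That is obtained
   without Hahn-Banach: if F is bounded and ||F||_Y > 1, its L^2-projection f0 onto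
   the unit ball of Y exists, f0 <= F, and g = F - f0 >= 0 satisfies
   ||g||_{Y'} <= \int g f0 < \int g F. *)
Require Import Defs.
From HB Require Import structures.
From mathcomp Require Import all_boot all_order all_algebra.
From mathcomp Require Import all_classical all_reals all_analysis measurable_realfun.
From mathcomp Require Import ring lra.
Import Order.TTheory GRing.Theory Num.Theory.
Import numFieldNormedType.Exports.
Local Open Scope classical_set_scope.
Local Open Scope ring_scope.
Local Open Scope ereal_scope.
Set Implicit Arguments. Unset Strict Implicit. Unset Printing Implicit Defensive.

(** * Rearrangements *)

Section Rearrangement.
Variable R : realType.
Local Notation mu := (@lebesgue_measure R).
Local Notation D := (@D01 R).
Implicit Types (f g h phi : R -> \bar R) (s t l : R).

Lemma D01P t : D t <-> (0 < t)%R /\ (t < 1)%R.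
Proof. by rewrite /D01 /= in_itv /=; split => [/andP|[-> ->]]. Qed.

Lemma measurable_D01 : measurable D.
Proof. exact: measurable_itv. Qed.
Hint Resolve measurable_D01 : core.

Lemma mu_D01 : mu D = 1.
Proof. by rewrite /D01 lebesgue_measure_itv /= lte_fin ltr01 sube0. Qed.

Lemma mu_sub_D01 (E : set R) : measurable E -> E `<=` D -> mu E <= 1.
Proof. by move=> mE ED; rewrite -mu_D01 le_measure ?inE. Qed.

Lemma mu_sub_D01_fin (E : set R) : measurable E -> E `<=` D ->
  mu E \is a fin_num.
Proof.
move=> mE ED; rewrite ge0_fin_numE//.
by rewrite (le_lt_trans (mu_sub_D01 mE ED))// ltry.
Qed.

Lemma mu_itv0 (a : R) : (0 <= a)%R -> mu `]0%R, a[ = a%:E.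
Proof.
rewrite lebesgue_measure_itv /= lte_fin sube0 le_eqVlt => /orP[/eqP <-|->//].
by rewrite ltxx.
Qed.

Definition noninc phi := forall s t, D s -> D t -> (s <= t)%R -> phi t <= phi s.

(** Superlevel sets of a nonincreasing function on [D] are intervals, and the half-lines above a
    real number generate the Borel sets of the extended line. *)
Lemma noninc_measurable phi : noninc phi -> measurable_fun D phi.
Proof.
move=> nphi; apply: (measurability _ (ErealGenOInfty.measurableE R)) => //.
move=> /= _ [_ [x -> <-]].
apply: is_interval_measurable => s t /= [Ds xs] [Dt xt] u /andP[su ut].
have Du : D u.
  move/D01P: Ds => [s0 s1]; move/D01P: Dt => [t0 t1]; apply/D01P; split.
    exact: lt_le_trans su.
  exact: le_lt_trans t1.
split => //; move: xt; rewrite /= !in_itv /= !andbT => xt.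
by rewrite (lt_le_trans xt)// nphi.
Qed.

(** * Distribution functions and the nonincreasing rearrangement *)

Lemma measurable_gt f l : measurable_fun D f ->
  measurable (D `&` [set x | l%:E < f x]).
Proof. by move=> mf; apply: measurable_lte. Qed.

Lemma distr_fun_le1 f l : measurable_fun D f -> distr_fun f l <= 1.
Proof. by move=> mf; apply: mu_sub_D01; [exact: measurable_gt|move=> ? []]. Qed.

Lemma distr_fun_fin f l : measurable_fun D f -> distr_fun f l \is a fin_num.
Proof. by move=> mf; apply: mu_sub_D01_fin; [exact: measurable_gt|move=> ? []]. Qed.

Lemma distr_fun_noninc f l l' : measurable_fun D f -> (l <= l')%R ->
  distr_fun f l' <= distr_fun f l.
Proof.
move=> mf ll'; apply: le_measure; rewrite ?inE; try exact: measurable_gt.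
by move=> x [Dx xl]; split=> //=; rewrite (le_lt_trans _ xl)// lee_fin.
Qed.

Lemma fstar_ge0 f t : 0 <= fstar f t.
Proof. by apply: le_ereal_inf_tmp => _ [l [l0 _] <-]; rewrite lee_fin. Qed.

Lemma fstar_noninc f : noninc (fstar f).
Proof.
move=> s t _ _ st; apply: le_ereal_inf => _ [l [l0 dl] <-]; exists l => //.
by split=> //; rewrite (le_trans dl)// lee_fin.
Qed.

Lemma Mplus_fstar f : Mplus (fstar f).
Proof.
split; first by apply: noninc_measurable; exact: fstar_noninc.
by move=> x _; exact: fstar_ge0.
Qed.

(** Right-continuity of the distribution function: the sets where [f] exceeds [l + 1/(n+1)] increase
    to the set where [f] exceeds [l], and the measure is continuous from below. *)
Lemma distr_fun_cvg f l : measurable_fun D f ->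
  distr_fun f (l + n.+1%:R^-1) @[n --> \oo] --> distr_fun f l.
Proof.
move=> mf; rewrite /distr_fun.
rewrite (_ : D `&` [set x | l%:E < f x] =
  \bigcup_n (D `&` [set x | (l + n.+1%:R^-1)%:E < f x])); last first.
  apply/seteqP; split=> [x [Dx /= lx]|x [n _ [Dx /= lx]]]; last first.
    by split=> //=; rewrite (le_lt_trans _ lx)// lee_fin lerDl.
  case fx : (f x) lx => [r| |] lx; last 2 first.
  - by exists 0%N => //; split=> //=; rewrite fx ltry.
  - by [].
  move: lx; rewrite lte_fin -subr_gt0 => lx.
  have [n nl] := ltr_add_invr lx.
  exists n => //; split=> //=; rewrite fx lte_fin.
  by move: nl; rewrite add0r ltrBrDl.
apply: nondecreasing_cvg_mu.
- by move=> n; exact: measurable_gt.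
- by apply: bigcup_measurable => n _; exact: measurable_gt.
- move=> n m nm; apply/subsetPset => x [Dx /= lx]; split=> //=.
  rewrite (le_lt_trans _ lx)// lee_fin lerD2l lef_pV2 ?posrE//.
  by rewrite ler_nat.
Qed.

(** Right-continuity of the distribution function means that a level [l >= fstar f t] is itself
    admissible in the infimum defining [fstar f t]. The superlevel sets of [fstar f] are read off
    from this equivalence. *)
Lemma lt_fstar f l t : measurable_fun D f -> (0 <= l)%R ->
  (l%:E < fstar f t) = (t%:E < distr_fun f l).
Proof.
move=> mf l0; rewrite !ltNge; congr (~~ _); apply/idP/idP => [fl|dl]; last first.
  by apply: ereal_inf_lbound; exists l.
apply: (cvge_le _ (distr_fun_cvg mf)).
apply: nearW => n.
have : fstar f t < (l + n.+1%:R^-1)%:E.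
  by rewrite (le_lt_trans fl)// lte_fin ltrDl.
move=> /ereal_inf_lt [_ [l' [l'0 dl'] <-]]; rewrite lte_fin => l'l.
by rewrite (le_trans _ dl')// distr_fun_noninc// ltW.
Qed.

Lemma fstar_gt_itv f l : measurable_fun D f -> (0 <= l)%R ->
  D `&` [set x | l%:E < fstar f x] = `]0%R, fine (distr_fun f l)[%classic.
Proof.
move=> mf l0; have df := distr_fun_fin l mf.
apply/seteqP; split=> x /=; rewrite !in_itv /=.
  by move=> [/D01P[-> _]]; rewrite lt_fstar// -{1}(fineK df) lte_fin.
move=> /andP[x0 xd]; rewrite lt_fstar//; split.
  apply/D01P; split=> //; rewrite (lt_le_trans xd)//.
  by rewrite -lee_fin fineK// distr_fun_le1.
by rewrite -(fineK df) lte_fin.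
Qed.

Lemma distr_fstar f l : measurable_fun D f -> (0 <= l)%R ->
  distr_fun (fstar f) l = distr_fun f l.
Proof.
move=> mf l0; rewrite {1}/distr_fun fstar_gt_itv// mu_itv0 ?fine_ge0//.
by rewrite fineK// distr_fun_fin.
Qed.

Lemma fstar_id f t : measurable_fun D f -> fstar (fstar f) t = fstar f t.
Proof.
move=> mf; congr ereal_inf; apply/seteqP.
by split=> _ [l [l0 dl] <-]; exists l => //; split=> //; move: dl; rewrite distr_fstar.
Qed.

Lemma equimeas_fstar f : Mplus f -> equimeas f (fstar f).
Proof. by move=> [mf f0]; split; [exact: Mplus_fstar|move=> t _; rewrite fstar_id]. Qed.

(** * Tonelli on rectangles, the Hardy-Littlewood inequality and exchange of tails *)

Lemma tonelli_restrict (A B : set R) (k : R * R -> \bar R) :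
  measurable A -> measurable B -> measurable_fun (A `*` B) k ->
  (forall p, (A `*` B) p -> 0 <= k p) ->
  \int[mu]_(x in A) \int[mu]_(y in B) k (x, y) =
  \int[mu]_(y in B) \int[mu]_(x in A) k (x, y).
Proof.
move=> mA mB mk k0.
have mAB : measurable (A `*` B) by exact: measurableX.
have E x y : (k \_ (A `*` B)) (x, y) =
   if x \in A then if y \in B then k (x, y) else 0 else 0.
  rewrite patchE; case: ifPn => [/set_mem[/= Ax By]|].
    by rewrite !mem_set.
  case: ifPn => // xA; case: ifPn => // yB.
  by rewrite mem_set//; split; exact: set_mem.
transitivity (\int[mu]_x \int[mu]_y (k \_ (A `*` B)) (x, y)).
  rewrite integral_mkcond; apply: eq_integral => x _; rewrite patchE.
  under [in RHS]eq_integral do rewrite E.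
  case: ifPn => xA; last by rewrite integral0.
  by rewrite [LHS]integral_mkcond; apply: eq_integral => y _; rewrite patchE.
transitivity (\int[mu]_y \int[mu]_x (k \_ (A `*` B)) (x, y)).
  apply: (@fubini_tonelli _ _ _ _ R mu mu (k \_ (A `*` B))).
    exact: (proj1 (measurable_restrictT k mAB) mk).
  by move=> p; rewrite patchE; case: ifPn => // /set_mem; exact: k0.
rewrite [RHS]integral_mkcond; apply: eq_integral => y _; rewrite patchE.
under eq_integral do rewrite E.
case: ifPn => yB; last by rewrite integral0_eq// => x _; case: ifP.
by rewrite [RHS]integral_mkcond; apply: eq_integral => x _; rewrite patchE.
Qed.

(** Exchange argument: the parts of [E] and of the initial interval [A] outside their intersection
    have equal measure, while [phi <= phi a] on the first and [phi >= phi a] on the second. *)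
Lemma bathtub phi (E : set R) : noninc phi -> (forall x, D x -> 0 <= phi x) ->
  measurable E -> E `<=` D ->
  \int[mu]_(x in E) phi x <= \int[mu]_(x in `]0%R, fine (mu E)[) phi x.
Proof.
move=> nphi phi0 mE ED; set a := fine (mu E).
have mphi := noninc_measurable nphi.
have Ef := mu_sub_D01_fin mE ED.
have muE : mu E = a%:E by rewrite /a fineK.
have a0 : (0 <= a)%R by rewrite fine_ge0.
have a1 : (a <= 1)%R by rewrite -lee_fin -muE mu_sub_D01.
set A : set R := `]0%R, a[%classic.
have mA : measurable A by exact: measurable_itv.
have AD : A `<=` D.
  by move=> x; rewrite /A/= in_itv/= => /andP[x0 xa]; apply/D01P; rewrite (lt_le_trans xa).
(* The cases [a = 0] and [a = 1] are split off because the threshold [phi a] is controlled only for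
   [a] in the open interval. *)
move: a0; rewrite le_eqVlt => /orP[/eqP a0|a0].
  have -> : \int[mu]_(x in E) phi x = 0.
    by apply: null_set_integral => //; [exact: measurable_funS mphi|rewrite [LHS]muE -a0].
  by apply: integral_ge0 => x /AD/phi0.
move: a1; rewrite le_eqVlt => /orP[/eqP a1|a1].
  by apply: ge0_subset_integral => //; rewrite /A a1//.
have Da : D a by apply/D01P.
have mEA := measurableI _ _ mE mA; have mEDA := measurableD mE mA.
have mADE := measurableD mA mE.
have sub (B : set R) : measurable B -> B `<=` D -> measurable_fun B phi.
  by move=> mB BD; exact: measurable_funS mphi.
have split_int (B C : set R) : measurable B -> measurable C -> B `<=` D ->
    \int[mu]_(x in B) phi x =
    \int[mu]_(x in B `&` C) phi x + \int[mu]_(x in B `\` C) phi x.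
  move=> mB mC BD; rewrite -ge0_integral_setU ?setUIDK//.
  - exact: measurableI.
  - exact: measurableD.
  - exact: sub.
  - by move=> x /BD/phi0.
  - by apply/disj_setPS => x [[_ ?] [_]].
rewrite (split_int E A)// (split_int A E)// setIC leeD2l//.
apply: (@le_trans _ _ (phi a * mu (E `\` A))).
  rewrite -integral_cst//; apply: ge0_le_integral => //.
  - by move=> x [/ED/phi0].
  - by apply: sub => // x [/ED].
  - move=> x [Ex nAx]; apply: nphi => //; first exact: ED.
    rewrite leNgt; apply/negP => xa; apply: nAx; rewrite /A/= in_itv/= xa andbT.
    by have /D01P[] := ED _ Ex.
have -> : mu (E `\` A) = mu (A `\` E).
  have f1 : mu (E `&` A) \is a fin_num by apply: mu_sub_D01_fin => // x [/ED].
  have e1 : mu (E `\` A) + mu (E `&` A) = a%:E.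
    by rewrite -muE; apply/esym; exact: measureDI.
  have e2 : mu (A `\` E) + mu (E `&` A) = a%:E.
    by rewrite -(mu_itv0 (ltW a0)) setIC; apply/esym; exact: measureDI.
  by rewrite -(addeK (mu (E `\` A)) f1) -(addeK (mu (A `\` E)) f1) e1 e2.
rewrite -integral_cst//; apply: ge0_le_integral => //.
- by move=> x _; exact: phi0.
- by apply: sub => // x [/AD].
- move=> x [Ax _]; apply: nphi => //; first exact: AD.
  by move: Ax; rewrite /A/= in_itv/= => /andP[_ /ltW].
Qed.

(** The value [f x], finite or not, is the length of the set of levels [l >= 0] below it; Tonelli
    then exchanges the level and the point. *)
Lemma layer_cake f phi : Mplus f -> Mplus phi ->
  \int[mu]_(x in D) (f x * phi x) =
  \int[mu]_(l in `[0%R, +oo[) \int[mu]_(x in D `&` [set x | l%:E < f x]) phi x.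
Proof.
move=> [mf f0] [mphi phi0].
set L : set R := `[0%R, +oo[%classic.
have mL : measurable L by exact: measurable_itv.
pose k (p : R * R) := if p.2%:E < f p.1 then phi p.1 else 0.
have m1 (g : R -> \bar R) : measurable_fun D g -> measurable_fun (D `*` L) (g \o fst).
  move=> mg; apply: (measurable_comp (F := D)) => //.
    by move=> _ [[x y] [/= Dx _] <-].
  exact: measurable_funTS.
have mk : measurable_fun (D `*` L) k.
  have mDL : measurable (D `*` L) by exact: measurableX.
  apply: measurable_fun_if => //.
  - apply: measurable_fun_lte; last exact: (m1 _ mf).
    by apply/measurable_EFinP; exact: measurable_funTS.
  - apply: measurable_funS (m1 _ mphi) => //.
transitivity (\int[mu]_(x in D) \int[mu]_(l in L) k (x, l)).
  apply: eq_integral => x /set_mem Dx.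
  transitivity (\int[mu]_(l in L `&` [set l | l%:E < f x]) cst (phi x) l).
    rewrite integral_cst; last first.
      by apply: measurable_lte => //; exact/measurable_EFinP.
    rewrite muleC; congr (_ * _); move: (f0 x Dx).
    case: (f x) => [r||//]; rewrite ?lee_fin => r0.
      transitivity (mu `[0%R, r[%classic).
        rewrite lebesgue_measure_itv/= lte_fin sube0.
        by case: ltgtP r0 => // <-.
      congr (mu _).
      by apply/seteqP; split=> l/=; rewrite /L/= !in_itv/= andbT ?lte_fin => /andP.
    transitivity (mu L); first by rewrite lebesgue_measure_itv/= ltry.
    congr (mu _).
    by apply/seteqP; split=> [l Ll|l []//]; split=> //=; rewrite ltry.
  rewrite integral_mkcondr; apply: eq_integral => l _.
  rewrite patchE /k/=; case: ifPn => [/set_mem/= ->//|].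
  by move=> /negP H; case: ifPn => // lf; exfalso; apply: H; exact/mem_set.
rewrite tonelli_restrict//; last first.
  by move=> [x l] [/= Dx _]; rewrite /k/=; case: ifP => // _; exact: phi0.
apply: eq_integral => l _.
rewrite integral_mkcondr; apply: eq_integral => x _.
rewrite patchE /k/=; case: ifPn => lf; first by rewrite mem_set.
by rewrite memNset//; apply/negP.
Qed.

(** Since [phi] is already nonincreasing, only [f] is rearranged. At each level the superlevel set
    of [f] is replaced by the initial interval of the same measure, and [bathtub] compares the
    two. *)
Lemma hardy_littlewood f phi : Mplus f -> noninc phi ->
  (forall x, D x -> 0 <= phi x) ->
  \int[mu]_(x in D) (f x * phi x) <= \int[mu]_(x in D) (fstar f x * phi x).
Proof.
move=> Mf nphi phi0; have mphi := noninc_measurable nphi.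
have Mphi : Mplus phi by [].
have [mf _] := Mf.
rewrite !layer_cake//; last exact: Mplus_fstar.
(* The inner integral is nonincreasing in the level, so its superlevel sets are intervals and it is
   measurable. *)
have mono (g : R -> \bar R) : Mplus g -> measurable_fun (`[0%R, +oo[%classic : set R)
    (fun l => \int[mu]_(x in D `&` [set x | l%:E < g x]) phi x).
  move=> [mg _].
  apply: measurable_funTS.
  apply: (measurability _ (ErealGenOInfty.measurableE R)) => //.
  move=> /= _ [_ [x -> <-]].
  apply: is_interval_measurable => s t /= [_ xs] [_ xt] u /andP[su ut].
  split => //; move: xt; rewrite /= !in_itv /= !andbT => xt.
  rewrite (lt_le_trans xt)//; apply: ge0_subset_integral.
  - exact: measurable_gt.
  - exact: measurable_gt.
  - by apply: measurable_funS mphi => // y [].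
  - by move=> y [/phi0].
  - by move=> y [Dy ty]; split=> //=; rewrite (le_lt_trans _ ty)// lee_fin.
apply: ge0_le_integral => //.
- by move=> l _; apply: integral_ge0 => x [/phi0].
- exact: mono.
- by apply: mono; exact: Mplus_fstar.
move=> l /=; rewrite in_itv/= andbT => l0.
rewrite fstar_gt_itv//; apply: bathtub => //; first exact: measurable_gt.
Qed.

(** Both sides integrate [g t * f s] over the triangle [t < s]. With a weight [1/I] included in [f],
    this is the passage from [H_I] to its adjoint. *)
Lemma fubini_tail f g : Mplus f -> Mplus g ->
  \int[mu]_(t in D) (g t * \int[mu]_(s in `]t, 1%R[) f s) =
  \int[mu]_(s in D) (f s * \int[mu]_(t in `]0%R, s[) g t).
Proof.
move=> [mf f0] [mg g0].
pose k (p : R * R) := if (p.1 < p.2)%R then ((g \o fst) \* (f \o snd)) p else 0.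
have mk : measurable_fun (D `*` D) k.
  have mDD : measurable (D `*` D) by exact: measurableX.
  apply: measurable_fun_if => //.
    by apply: measurable_funTS; exact: measurable_fun_ltr.
  apply: (@measurable_funS _ _ _ _ (D `*` D)) => //.
  have m1 : measurable_fun (D `*` D) (g \o fst).
    apply: (measurable_comp (F := D)) => //; last exact: measurable_funTS.
    by move=> _ [[x y] [/= Dx _] <-].
  have m2 : measurable_fun (D `*` D) (f \o snd).
    apply: (measurable_comp (F := D)) => //; last exact: measurable_funTS.
    by move=> _ [[x y] [/= _ Dy] <-].
  exact: (emeasurable_funM m1 m2).
transitivity (\int[mu]_(t in D) \int[mu]_(s in D) k (t, s)).
  apply: eq_integral => t /set_mem Dt.
  have sD : `]t, 1%R[ `<=` D.
    move=> s /=; rewrite in_itv/= => /andP[ts s1]; apply/D01P.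
    by split=> //; apply: lt_trans ts; move/D01P: Dt => [].
  rewrite -ge0_integralZl//; last 3 first.
  - exact: measurable_funS mf.
  - by move=> s /sD/f0.
  - exact: g0.
  rewrite (_ : `]t, 1%R[%classic = D `&` `]t, 1%R[%classic); last first.
    by apply/esym/setIidPr.
  rewrite integral_mkcondr; apply: eq_integral => s /set_mem/D01P[_ s1].
  rewrite patchE /k/=; case: ifPn => [|/negP].
    by move/set_mem; rewrite /= in_itv/= => /andP[->].
  by case: ifPn => // ts []; apply/mem_set; rewrite /= in_itv/= ts.
rewrite tonelli_restrict//; last first.
  move=> [t s] [/= Dt Ds]; rewrite /k/=; case: ifP => // _.
  by rewrite mule_ge0 ?f0 ?g0.
apply: eq_integral => s /set_mem Ds.
have sD : `]0%R, s[ `<=` D.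
  move=> t /=; rewrite in_itv/= => /andP[t0 ts]; apply/D01P.
  by split=> //; apply: lt_trans ts _; move/D01P: Ds => [].
rewrite -ge0_integralZl//; last 3 first.
- exact: measurable_funS mg.
- by move=> t /sD/g0.
- exact: f0.
rewrite (_ : `]0%R, s[%classic = D `&` `]0%R, s[%classic); last first.
  by apply/esym/setIidPr.
rewrite integral_mkcondr; apply: eq_integral => t /set_mem/D01P[t0 _].
rewrite patchE /k/=.
have -> : (t \in `]0%R, s[%classic) = (t < s)%R.
  by apply/idP/idP => [/set_mem|ts]; [|apply/mem_set]; rewrite /= in_itv/= t0.
by case: ifP => // _; rewrite muleC.
Qed.

End Rearrangement.

#[local] Hint Extern 0 (measurable (@D01 _)) => exact: measurable_D01 : core.

(** * The operators H_I and T_I *)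

Section Operators.
Variables (R : realType) (I : R -> R).
Hypothesis qI : quasiconcave I.
Local Notation mu := (@lebesgue_measure R).
Local Notation D := (@D01 R).
Implicit Types (f g h : R -> \bar R) (s t r : R).

Lemma nondec_measurable (phi : R -> \bar R) :
  (forall s t, D s -> D t -> (s <= t)%R -> phi s <= phi t) -> measurable_fun D phi.
Proof.
move=> nphi; rewrite (_ : phi = -%E \o (-%E \o phi)); last first.
  by apply/funext => x /=; rewrite oppeK.
apply: measurableT_comp => //; apply: noninc_measurable => s t Ds Dt st /=.
by rewrite leeN2 nphi.
Qed.

Lemma sub_tail t : D t -> `]t, 1%R[ `<=` D.
Proof.
move=> /D01P[t0 _] s /=; rewrite in_itv/= => /andP[ts s1]; apply/D01P.
by split=> //; exact: lt_trans ts.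
Qed.

Lemma sub_head t : D t -> `]0%R, t[ `<=` D.
Proof.
move=> /D01P[_ t1] s /=; rewrite in_itv/= => /andP[s0 st]; apply/D01P.
by split=> //; exact: lt_trans st _.
Qed.

Lemma qc_gt0 t : D t -> (0 < I t)%R.
Proof. by case: qI => _ [h _] /h /D01P[]. Qed.

Lemma D01_gt0 t : D t -> (0 < t)%R.
Proof. by move=> /D01P[]. Qed.

Lemma qc_le s t : D s -> D t -> (s <= t)%R -> (I s <= I t)%R.
Proof. by case: qI => h _; exact: h. Qed.

Lemma qc_div_le s t : D s -> D t -> (s <= t)%R -> (I t / t <= I s / s)%R.
Proof. by case: qI => _ [_ [_ [_ [_ [_ h]]]]]; exact: h. Qed.

Lemma qc_div_gt0 t : D t -> (0 < I t / t)%R.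
Proof. by move=> Dt; rewrite divr_gt0 ?qc_gt0 ?D01_gt0. Qed.

Lemma noninc_qcV : noninc (fun t => ((I t)^-1)%:E).
Proof. by move=> s t Ds Dt st; rewrite lee_fin lef_pV2 ?posrE ?qc_gt0// qc_le. Qed.

Lemma noninc_qc_div : noninc (fun t => (I t / t)%:E).
Proof. by move=> s t Ds Dt st; rewrite lee_fin qc_div_le. Qed.

Lemma Mplus_weight h : Mplus h -> Mplus (fun s => h s * ((I s)^-1)%:E).
Proof.
move=> [mh h0]; split.
  by apply: emeasurable_funM => //; apply: noninc_measurable; exact: noninc_qcV.
by move=> x Dx; rewrite mule_ge0 ?h0// lee_fin invr_ge0 ltW// qc_gt0.
Qed.

Lemma eq_H_op g h t : D t -> (forall s, D s -> g s = h s) ->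
  H_op I g t = H_op I h t.
Proof.
by move=> Dt gh; apply: eq_integral => s /set_mem /(sub_tail Dt) Ds; rewrite gh.
Qed.

Lemma H_op_noninc h : Mplus h -> noninc (H_op I h).
Proof.
move=> /Mplus_weight[mh h0] s t Ds Dt st; apply: ge0_subset_integral => //.
- by apply: measurable_funS mh => //; exact: sub_tail.
- by move=> x /(sub_tail Ds)/h0.
- move=> x /=; rewrite !in_itv/= => /andP[tx ->]; rewrite andbT.
  exact: le_lt_trans tx.
Qed.

Lemma Mplus_H_op h : Mplus h -> Mplus (H_op I h).
Proof.
move=> Mh; split; first by apply: noninc_measurable; exact: H_op_noninc.
move=> t Dt; apply: integral_ge0 => s /(sub_tail Dt).
by case: (Mplus_weight Mh) => _; exact.
Qed.

(** * The supremum inside [T_I] and lower bounds for [T_I] *)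

Let S g t := ereal_sup [set (s / I s)%:E * fstar g s | s in `[t, 1%R[].

Let S_ge g t s : D t -> D s -> (t <= s)%R -> fstar g s <= (I s / s)%:E * S g t.
Proof.
move=> Dt Ds ts.
have <- : (I s / s)%:E * ((s / I s)%:E * fstar g s) = fstar g s.
  have s0 : s != 0%R by rewrite gt_eqF// D01_gt0.
  have Is0 : I s != 0%R by rewrite gt_eqF// qc_gt0.
  by rewrite muleA -EFinM mulrA divfK// divff// mul1e.
rewrite lee_wpmul2l//; first by rewrite lee_fin ltW// qc_div_gt0.
apply: ereal_sup_ubound; exists s => //=.
by rewrite in_itv/= ts; case/D01P: Ds.
Qed.

Let S_ge0 g t : D t -> 0 <= S g t.
Proof.
move=> Dt; apply: le_ereal_sup_tmp; exists ((t / I t)%:E * fstar g t).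
  by exists t => //=; rewrite in_itv/= lexx; case/D01P: Dt.
by rewrite mule_ge0 ?fstar_ge0// lee_fin divr_ge0// ltW// ?qc_gt0// D01_gt0.
Qed.

Let S_noninc g : noninc (S g).
Proof.
move=> s t Ds Dt st; apply: le_ereal_sup => _ [u /= ut <-]; exists u => //=.
by move: ut; rewrite !in_itv/= => /andP[tu ->]; rewrite andbT (le_trans st).
Qed.

Lemma Mplus_T_op g : Mplus (T_op I g).
Proof.
split.
  apply: emeasurable_funM; first by apply: noninc_measurable; exact: noninc_qc_div.
  by apply: noninc_measurable; exact: S_noninc.
by move=> t Dt; rewrite mule_ge0 ?S_ge0// lee_fin ltW// qc_div_gt0.
Qed.

Lemma fstar_le_T_op g t : D t -> fstar g t <= T_op I g t.
Proof. by move=> Dt; exact: S_ge. Qed.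

Let G g r := \int[mu]_(t in `]0%R, r[) fstar g t.

Let mfs g (A : set R) : measurable A -> A `<=` D -> measurable_fun A (fstar g).
Proof. by move=> mA AD; have [mg _] := Mplus_fstar g; exact: measurable_funS mg. Qed.

Let mTs g (A : set R) : measurable A -> A `<=` D -> measurable_fun A (T_op I g).
Proof. by move=> mA AD; have [mg _] := Mplus_T_op g; exact: measurable_funS mg. Qed.

Let G_le_T g s : D s -> G g s <= \int[mu]_(t in `]0%R, s[) T_op I g t.
Proof.
move=> Ds; apply: ge0_le_integral => //.
- by move=> x _; exact: fstar_ge0.
- by apply: mfs => //; exact: sub_head.
- by apply: mTs => //; exact: sub_head.
- by move=> x /(sub_head Ds); exact: fstar_le_T_op.
Qed.

(** On []0, s[] both factors of [T_I g] are at least their values at [s], so [T_I g] dominates the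
    constant [(I s / s) * S g s] there; integrating over an interval of length [s] leaves
    [I s * S g s]. *)
Let S_le_T g s : D s ->
  S g s <= ((I s)^-1)%:E * \int[mu]_(t in `]0%R, s[) T_op I g t.
Proof.
move=> Ds; have Is := qc_gt0 Ds.
have -> : S g s = ((I s)^-1)%:E * ((I s)%:E * S g s).
  by rewrite muleA -EFinM mulVf ?mul1e// gt_eqF.
rewrite lee_wpmul2l//; first by rewrite lee_fin invr_ge0 ltW.
have -> : (I s)%:E * S g s =
    \int[mu]_(t in `]0%R, s[) cst ((I s / s)%:E * S g s) t.
  rewrite integral_cst// [X in _ = _ * X](_ : _ = s%:E).
    have s0 : s != 0%R by rewrite gt_eqF// D01_gt0.
    have <- : (I s / s * s)%:E = (I s)%:E by rewrite divfK.
    by rewrite EFinM muleAC.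
  by rewrite -[RHS]mu_itv0// ltW// D01_gt0.
apply: ge0_le_integral => //.
- by move=> x _; rewrite mule_ge0 ?S_ge0// lee_fin ltW// qc_div_gt0.
- by apply: mTs => //; exact: sub_head.
- move=> x xs; have Dx := sub_head Ds xs.
  have xs' : (x <= s)%R by move: xs; rewrite /= in_itv/= => /andP[_ /ltW].
  apply: lee_pmul; rewrite ?S_ge0 ?S_noninc// lee_fin.
    by rewrite ltW// qc_div_gt0.
  exact: qc_div_le.
Qed.

(** * The duality estimate under the integral condition on [I] *)

Variable C : R.
Hypothesis C0 : (0 < C)%R.
Hypothesis intI : forall t, D t ->
  \int[mu]_(s in `]0%R, t[) ((I s / s)%:E) <= C%:E * (I t)%:E.

(** On [[s, r[] the supremum [S g s] gives [g^*(x) <= (I x / x) * S g s], and the integral of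
    [I x / x] over the larger interval []0, r[] is at most [C * I r]. *)
Let G_split g s r : D s -> D r -> (s <= r)%R ->
  G g r <= G g s + C%:E * (I r)%:E * S g s.
Proof.
move=> Ds Dr sr.
have sub : `[s, r[ `<=` D.
  move=> x /=; rewrite in_itv/= => /andP[sx xr]; apply: (sub_head Dr).
  by rewrite /= in_itv/= xr andbT (lt_le_trans _ sx)// D01_gt0.
have sub' : `[s, r[ `<=` `]0%R, r[.
  move=> x /=; rewrite !in_itv/= => /andP[sx ->].
  by rewrite andbT (lt_le_trans _ sx)// D01_gt0.
have mdiv (A : set R) : measurable A -> A `<=` D ->
    measurable_fun A (fun t => (I t / t)%:E).
  by move=> mA AD; apply: (measurable_funS _ AD (noninc_measurable noninc_qc_div)).
have E : `]0%R, r[%classic = `]0%R, s[%classic `|` `[s, r[%classic.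
  apply/seteqP; split=> x /=; rewrite !in_itv/=.
    by move=> /andP[x0 xr]; case: (ltP x s) => xs; [left; rewrite x0|right].
  case=> /andP[a b]; first by rewrite a (lt_le_trans b).
  by rewrite b andbT (lt_le_trans _ a)// D01_gt0.
rewrite /G E ge0_integral_setU//; last 3 first.
- by rewrite -E; apply: mfs => //; exact: sub_head.
- by move=> x _; exact: fstar_ge0.
- apply/disj_setPS => x [/=]; rewrite !in_itv/= => /andP[_ xs] /andP[sx _].
  by move: xs; rewrite ltNge sx.
rewrite leeD2l//.
apply: (@le_trans _ _ (\int[mu]_(x in `[s, r[) (S g s * (I x / x)%:E))).
  apply: ge0_le_integral => //.
  - by move=> x _; exact: fstar_ge0.
  - exact: mfs.
  - by apply: emeasurable_funM => //; exact: mdiv.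
  - move=> x xsr; rewrite muleC; apply: S_ge => //; first exact: sub.
    by move: xsr; rewrite /= in_itv/= => /andP[].
have pos x : D x -> 0 <= (I x / x)%:E by move=> Dx; rewrite lee_fin ltW// qc_div_gt0.
rewrite ge0_integralZl//; last 3 first.
- exact: mdiv.
- by move=> x /sub/pos.
- exact: S_ge0.
rewrite muleC lee_wpmul2r ?S_ge0//; apply: le_trans (intI Dr).
apply: ge0_subset_integral => //; first by apply: mdiv => //; exact: sub_head.
by move=> x /(sub_head Dr)/pos.
Qed.

(* The least nonincreasing majorant of [G g / I]. *)
Let W g s := ereal_sup [set ((I r)^-1)%:E * G g r | r in `[s, 1%R[].

Let W_noninc g : noninc (W g).
Proof.
move=> s t Ds Dt st; apply: le_ereal_sup => _ [u /= ut <-]; exists u => //=.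
by move: ut; rewrite !in_itv/= => /andP[tu ->]; rewrite andbT (le_trans st).
Qed.

Let G_ge0 g s : 0 <= G g s.
Proof. by apply: integral_ge0 => x _; exact: fstar_ge0. Qed.

Let W_ge g s : D s -> ((I s)^-1)%:E * G g s <= W g s.
Proof.
move=> Ds; apply: ereal_sup_ubound; exists s => //=.
by rewrite in_itv/= lexx; case/D01P: Ds.
Qed.

Let W_ge0 g s : D s -> 0 <= W g s.
Proof.
move=> Ds; apply: le_trans (W_ge g Ds).
by rewrite mule_ge0// lee_fin invr_ge0 ltW// qc_gt0.
Qed.

(** After [G_split], division by [I r] cancels the factor [I r] in the second term and is weaker
    than division by [I s] in the first. Each term is then compared with the mean of [T_I g],
    contributing [1] and [C] respectively. *)
Let W_le g s : D s ->
  W g s <= (1 + C)%:E * (((I s)^-1)%:E * \int[mu]_(t in `]0%R, s[) T_op I g t).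
Proof.
move=> Ds; apply: ge_ereal_sup => x [r /=]; rewrite in_itv/= => /andP[sr r1] <-{x}.
have Dr : D r by apply/D01P; rewrite r1 (lt_le_trans _ sr)// D01_gt0.
have Ir : 0 <= ((I r)^-1)%:E by rewrite lee_fin invr_ge0 ltW// qc_gt0.
set A := \int[mu]_(t in _) _.
have A0 : 0 <= A by apply: integral_ge0 => x /(sub_head Ds); case: (Mplus_T_op g) => _; exact.
have Is : 0 <= ((I s)^-1)%:E by rewrite lee_fin invr_ge0 ltW// qc_gt0.
have IA0 : 0 <= ((I s)^-1)%:E * A by rewrite mule_ge0.
apply: (@le_trans _ _ (((I r)^-1)%:E * (G g s + C%:E * (I r)%:E * S g s))).
  by rewrite lee_wpmul2l// G_split.
rewrite ge0_muleDr//; last by rewrite mule_ge0 ?S_ge0// -EFinM lee_fin mulr_ge0// ltW// qc_gt0.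
rewrite EFinD ge0_muleDl ?lee_fin ?ler01 ?(ltW C0)// mul1e; apply: leeD.
  apply: lee_pmul => //; last exact: G_le_T.
  exact: noninc_qcV.
have e : ((I r)^-1)%:E * (C%:E * (I r)%:E) = C%:E.
  transitivity ((I r)^-1 * (C * I r))%:E => //.
  by rewrite mulrCA mulVf ?mulr1// gt_eqF// qc_gt0.
rewrite muleA e.
by rewrite lee_wpmul2l ?lee_fin ?(ltW C0)//; exact: S_le_T.
Qed.

Lemma H_op_duality g h : Mplus g -> Mplus h ->
  \int[mu]_(t in D) (H_op I h t * g t) <=
  (1 + C)%:E * \int[mu]_(t in D) (H_op I (fstar h) t * T_op I g t).
Proof.
move=> Mg Mh.
have [mHh Hh0] := Mplus_H_op Mh.
have [mh h0] := Mh.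
have [mfh fh0] := Mplus_fstar h.
have Mw := Mplus_weight Mh; have Mw' := Mplus_weight (Mplus_fstar h).
have MT := Mplus_T_op g.
have C1 : (0 <= 1 + C)%R by rewrite addr_ge0// ltW.
have mW : measurable_fun D (W g) by apply: noninc_measurable; exact: W_noninc.
have mhead (k : R -> \bar R) : Mplus k ->
    measurable_fun D (fun s => \int[mu]_(t in `]0%R, s[) k t).
  move=> [mk k0]; apply: nondec_measurable => s t Ds Dt st.
  apply: ge0_subset_integral => //.
  - by apply: measurable_funS mk => //; exact: sub_head.
  - by move=> x /(sub_head Dt)/k0.
  - by move=> x /=; rewrite !in_itv/= => /andP[-> xs]; exact: lt_le_trans st.
have head0 (k : R -> \bar R) s : Mplus k -> D s -> 0 <= \int[mu]_(t in `]0%R, s[) k t.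
  by move=> [_ k0] Ds; apply: integral_ge0 => x /(sub_head Ds)/k0.
under eq_integral do rewrite muleC.
apply: le_trans (hardy_littlewood Mg (H_op_noninc Mh) Hh0) _.
rewrite [X in X <= _](fubini_tail Mw (Mplus_fstar g)).
(* The quotient [G g / I] need not be monotone; passing to its majorant [W g] is what makes the
   second use of [hardy_littlewood] possible. *)
apply: (@le_trans _ _ (\int[mu]_(s in D) (h s * W g s))).
  apply: ge0_le_integral => //.
  - by move=> x Dx; rewrite mule_ge0//; [case: Mw => _; exact|exact: G_ge0].
  - apply: emeasurable_funM; first by case: Mw.
    by apply: mhead; exact: Mplus_fstar.
  - exact: emeasurable_funM.
  - by move=> x Dx; rewrite -muleA lee_wpmul2l ?h0//; exact: W_ge.
apply: le_trans (hardy_littlewood Mh (@W_noninc g) _) _.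
  by move=> x; exact: W_ge0.
under [in leRHS]eq_integral do rewrite muleC.
rewrite [X in _ <= _ * X](fubini_tail Mw' MT).
rewrite -ge0_integralZl//; last 2 first.
- by apply: emeasurable_funM; [case: Mw'|exact: mhead].
- by move=> x Dx; rewrite mule_ge0 ?head0//; case: Mw' => _; exact.
apply: ge0_le_integral => //.
- by move=> x Dx; rewrite mule_ge0 ?fh0// W_ge0.
- exact: emeasurable_funM.
- apply: emeasurable_funM => //.
  by apply: emeasurable_funM; [case: Mw'|exact: mhead].
- move=> x Dx; rewrite -(muleA (fstar h x)) (muleCA (1 + C)%:E) lee_wpmul2l ?fh0//.
  exact: W_le.
Qed.

End Operators.

(** * Bounded functions on (0,1) *)

Section BoundedFunctions.
Variable R : realType.
Local Notation mu := (@lebesgue_measure R).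
Local Notation D := (@D01 R).
Implicit Types f g h : R -> R.

(** Real values instead of extended ones let the Hilbert space arguments below subtract functions
    freely; boundedness on [D] makes all sums and products integrable. *)
Definition bdd f := measurable_fun D f /\ exists M : R, forall x, D x -> (`|f x| <= M)%R.

Lemma bdd_cst (a : R) : bdd (fun=> a).
Proof. by split => //; exists `|a|%R. Qed.

Lemma bddD f g : bdd f -> bdd g -> bdd (fun x => f x + g x)%R.
Proof.
move=> [mf [M fM]] [mg [N gN]]; split; first exact: measurable_funD.
by exists (M + N)%R => x Dx; rewrite (le_trans (ler_normD _ _))// lerD ?fM ?gN.
Qed.

Lemma bddB f g : bdd f -> bdd g -> bdd (fun x => f x - g x)%R.
Proof.
move=> [mf [M fM]] [mg [N gN]]; split; first exact: measurable_funB.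
by exists (M + N)%R => x Dx; rewrite (le_trans (ler_normB _ _))// lerD ?fM ?gN.
Qed.

Lemma bddM f g : bdd f -> bdd g -> bdd (fun x => f x * g x)%R.
Proof.
move=> [mf [M fM]] [mg [N gN]]; split; first exact: measurable_funM.
by exists (M * N)%R => x Dx; rewrite normrM ler_pM ?fM ?gN.
Qed.

Lemma bddZ (a : R) f : bdd f -> bdd (fun x => a * f x)%R.
Proof. exact/bddM/bdd_cst. Qed.

Lemma bdd_norm f : bdd f -> bdd (fun x => `|f x|)%R.
Proof.
move=> [mf [M fM]]; split; first by apply: measurableT_comp.
by exists M => x Dx; rewrite normr_id fM.
Qed.

Lemma bdd_min f g : bdd f -> bdd g -> bdd (fun x => Num.min (f x) (g x)).
Proof.
move=> [mf [M fM]] [mg [N gN]]; split; first exact: measurable_minr.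
exists (Num.max M N) => x Dx; rewrite le_max.
by rewrite /Num.min; case: ifP => _; rewrite ?fM ?gN ?orbT.
Qed.

Lemma bdd_integrable f : bdd f -> mu.-integrable D (EFin \o f).
Proof.
move=> [mf [M fM]]; apply: measurable_bounded_integrable => //.
  by rewrite [X in X < _](mu_D01 R) ltry.
exists M; split; first exact: num_real.
by move=> N MN x Dx; rewrite /= (le_trans (fM x Dx))// ltW.
Qed.

Definition int01 f : R := (\int[mu]_(x in D) f x)%R.

Lemma int01_EFin f : bdd f -> \int[mu]_(x in D) (f x)%:E = (int01 f)%:E.
Proof. by move=> /bdd_integrable fi; rewrite /int01 /Rintegral fineK//; exact: integrable_fin_num. Qed.

Lemma int01D f g : bdd f -> bdd g -> int01 (fun x => f x + g x)%R = (int01 f + int01 g)%R.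
Proof. by move=> /bdd_integrable bf /bdd_integrable bg; exact: RintegralD. Qed.

Lemma int01B f g : bdd f -> bdd g -> int01 (fun x => f x - g x)%R = (int01 f - int01 g)%R.
Proof. by move=> /bdd_integrable bf /bdd_integrable bg; exact: RintegralB. Qed.

Lemma int01Z (a : R) f : bdd f -> int01 (fun x => a * f x)%R = (a * int01 f)%R.
Proof. by move=> /bdd_integrable bf; exact: RintegralZl. Qed.

Lemma le_int01 f g : bdd f -> bdd g -> (forall x, D x -> (f x <= g x)%R) ->
  (int01 f <= int01 g)%R.
Proof. by move=> /bdd_integrable bf /bdd_integrable bg fg; rewrite /int01; exact: le_Rintegral. Qed.

Lemma int01_ge0 f : (forall x, D x -> (0 <= f x)%R) -> (0 <= int01 f)%R.
Proof. by move=> f0; rewrite /int01; apply: Rintegral_ge0. Qed.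

Lemma eq_int01 f g : (forall x, D x -> f x = g x) -> int01 f = int01 g.
Proof. by move=> fg; apply: eq_Rintegral => x /set_mem; exact: fg. Qed.

Lemma int01_cst (a : R) : int01 (fun=> a) = a.
Proof. by rewrite /int01 Rintegral_cst// [X in fine X](mu_D01 R) mulr1. Qed.

Lemma bdd_Mplus f : bdd f -> (forall x, D x -> (0 <= f x)%R) -> Mplus (EFin \o f).
Proof. by move=> [mf _] f0; split; [exact/measurable_EFinP|move=> x /f0]. Qed.

(* Fast decay of the mean squares of the increments makes the series of their
   absolute values integrable, hence finite almost everywhere. *)
Lemma cvg_of_sq_increments (f_ : nat -> R -> R) : (forall n, bdd (f_ n)) ->
  (forall n, int01 (fun x => (f_ n.+1 x - f_ n x) * (f_ n.+1 x - f_ n x))%R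
               <= 4 * ((2 ^ n)%:R ^+ 2)^-1)%R ->
  {ae mu, forall x, D x -> cvgn (f_ ^~ x)}.
Proof.
move=> bf sq.
pose u n x := (`|f_ n.+1 x - f_ n x|)%R.
have bu n : bdd (u n) by apply: bdd_norm; exact: bddB.
(* With [p = 2^n], the inequality [|d| <= p * d^2 + 1/p] turns the bound on squares into
   [4/p + 1/p = 5/p]. It is written as [10 / 2^(n+1)] to match the geometric series summed by
   [epsilon_trick0]. *)
have uJ n : (int01 (u n) <= 10 / (2 ^ n.+1)%:R)%R.
  set p : R := (2 ^ n)%:R.
  have p0 : (0 < p)%R by rewrite ltr0n expn_gt0.
  have bs : bdd (fun x => (f_ n.+1 x - f_ n x) * (f_ n.+1 x - f_ n x))%R.
    by apply: bddM; exact: bddB.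
  apply: (@le_trans _ _ (p * int01 (fun x => (f_ n.+1 x - f_ n x) * (f_ n.+1 x - f_ n x))%R + p^-1)%R).
    rewrite -int01Z// -[X in (_ + X)%R]int01_cst -int01D//; [|exact: bddZ|exact: bdd_cst].
    apply: le_int01 => //; first by apply: bddD; [exact: bddZ|exact: bdd_cst].
    move=> x _; rewrite /u; set d := (f_ n.+1 x - f_ n x)%R.
    have -> : (d * d = `|d| * `|d|)%R by rewrite -normrM ger0_norm// -expr2 sqr_ge0.
    have [dp|pd] := leP `|d|%R (p^-1)%R.
      by rewrite (le_trans dp)// lerDr mulr_ge0 ?mulr_ge0// ltW.
    rewrite (@le_trans _ _ (p * (`|d| * `|d|))%R)//; last by rewrite lerDl invr_ge0 ltW.
    rewrite mulrA ler_peMl// -(mulVf (lt0r_neq0 p0)) mulrC ler_pM2l//.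
    exact: ltW.
  have := sq n; rewrite -/p -(ler_pM2l p0) => H.
  have -> : (10 / (2 ^ n.+1)%:R = p * (4 * (p ^+ 2)^-1) + p^-1)%R.
    rewrite expnS natrM -/p; field; exact: lt0r_neq0.
  by rewrite lerD2r.
have uE n : \int[mu]_(x in D) (u n x)%:E <= (10 / (2 ^ n.+1)%:R)%:E.
  by rewrite int01_EFin// lee_fin.
pose U x := \sum_(0 <= n <oo) (u n x)%:E.
have mu_ n : measurable_fun D (fun x => (u n x)%:E).
  by apply/measurable_EFinP; case: (bu n).
have U0 x : 0 <= U x by apply: nneseries_ge0 => n _ _; rewrite lee_fin normr_ge0.
have Ui : mu.-integrable D U.
  apply/integrableP; split.
    apply: ge0_emeasurable_sum => [n x _ _|n _]; last exact: mu_.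
    by rewrite lee_fin normr_ge0.
  under eq_integral do rewrite gee0_abs//.
  rewrite integral_nneseries//; last by move=> n x _; rewrite lee_fin normr_ge0.
  apply: (@le_lt_trans _ _ (\sum_(0 <= n <oo) (10 / (2 ^ n.+1)%:R : R)%:E)).
    apply: lee_nneseries => // n _ _.
    by apply: integral_ge0 => x _; rewrite lee_fin normr_ge0.
  by apply: le_lt_trans (epsilon_trick0 _ _) _ => //; rewrite ltry.
have := @integrable_ae _ _ _ _ _ _ _ Ui => /(_ (@measurable_D01 R)).
apply: filterS => x /[apply] Ufin.
(* A finite [U x] bounds the partial sums of the absolute increments, so the telescoping series
   converges absolutely. *)
have : cvgn (series (telescope (f_ ^~ x))).
  apply: normed_cvg; apply: nondecreasing_is_cvgn.
    apply/nondecreasing_seqP => n; rewrite [leRHS]seriesSr.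
    by rewrite lerDl normr_ge0.
  exists (fine (U x)) => _ [n _ <-].
  rewrite -lee_fin fineK// /series/= -sumEFin.
  by apply: nneseries_lim_ge => k _ _; rewrite lee_fin normr_ge0.
rewrite telescopeK => H.
rewrite (_ : f_ ^~ x = [sequence (f_ n x - f_ 0%N x)%R]_n + cst (f_ 0%N x))%R.
  by apply: is_cvgD => //; exact: is_cvg_cst.
by apply/funext => n; rewrite fctE subrK.
Qed.

End BoundedFunctions.

(** * Duality *)

Section Duality.
Variables (R : realType) (rho : (R -> \bar R) -> \bar R).
Hypothesis rho_ri : ri_norm rho.
Local Notation mu := (@lebesgue_measure R).
Local Notation D := (@D01 R).

(** * Norm axioms and the Fatou property *)

Lemma rho_ge0 (f : R -> \bar R) : Mplus f -> 0 <= rho f.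
Proof. by case: rho_ri => + _; exact. Qed.

Lemma rho_homog (f : R -> \bar R) (a : R) : Mplus f -> (0 <= a)%R ->
  rho (fun x => a%:E * f x) = a%:E * rho f.
Proof. by case: rho_ri => _ [_ [+ _]]; exact. Qed.

Lemma rho_triangle (f g : R -> \bar R) : Mplus f -> Mplus g ->
  rho (fun x => f x + g x) <= rho f + rho g.
Proof. by case: rho_ri => _ [_ [_ [+ _]]]; exact. Qed.

Lemma rho_ae_le (f g : R -> \bar R) : Mplus f -> Mplus g ->
  {ae mu, forall x, D x -> g x <= f x} -> rho g <= rho f.
Proof. by case: rho_ri => _ [_ [_ [_ [+ _]]]]; exact. Qed.

Lemma rho_le (f g : R -> \bar R) : Mplus f -> Mplus g ->
  (forall x, D x -> g x <= f x) -> rho g <= rho f.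
Proof. by move=> Mf Mg gf; apply: rho_ae_le => //; exact: aeW. Qed.

Lemma rho_cvg (F : nat -> R -> \bar R) (f : R -> \bar R) :
  (forall n, Mplus (F n)) -> Mplus f ->
  (forall x, D x -> {homo (fun n => F n x) : n m / (n <= m)%N >-> n <= m}) ->
  (forall x, D x -> (fun n => F n x) @ \oo --> f x) ->
  (fun n => rho (F n)) @ \oo --> rho f.
Proof. by case: rho_ri => _ [_ [_ [_ [_ [+ _]]]]]; exact. Qed.

Lemma rho_eq0 (f : R -> \bar R) : Mplus f ->
  (rho f = 0 <-> {ae mu, forall x, D x -> f x = 0}).
Proof. by case: rho_ri => _ [+ _]; exact. Qed.

Lemma eq_rho (f g : R -> \bar R) : Mplus f -> Mplus g ->
  (forall x, D x -> f x = g x) -> rho f = rho g.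
Proof. by move=> Mf Mg fg; apply/eqP; rewrite eq_le !rho_le// => x /fg ->. Qed.

(** The tail infima increase to the lower limit, and each is dominated by a term of norm at most
    one; the monotone continuity of [rho] carries the bound to the limit. *)
Lemma rho_fatou (F : nat -> R -> \bar R) : (forall n, Mplus (F n)) ->
  (forall n, rho (F n) <= 1) ->
  Mplus (fun x => limn_einf (F ^~ x)) /\ rho (fun x => limn_einf (F ^~ x)) <= 1.
Proof.
move=> MF F1.
pose u n x := einfs (F ^~ x) n.
have Mu n : Mplus (u n).
  split; first by apply: measurable_fun_einfs => k; case: (MF k).
  move=> x Dx; apply: le_ereal_inf_tmp => _ [k _ <-].
  by case: (MF k) => _; exact.
have ucvg x : u ^~ x @ \oo --> limn_einf (F ^~ x).
  by rewrite limn_einf_lim; exact: is_cvg_einfs.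
have ML : Mplus (fun x => limn_einf (F ^~ x)).
  split; first by apply: (emeasurable_fun_cvg u) => // n; case: (Mu n).
  move=> x Dx; apply: (cvge_ge _ (ucvg x)); apply: nearW => n.
  by case: (Mu n) => _; exact.
split=> //.
have := rho_cvg Mu ML (fun x _ => nondecreasing_einfs (F ^~ x)) (fun x _ => ucvg x).
apply: cvge_le; apply: nearW => n; apply: le_trans (F1 n).
by apply: rho_le => // x Dx; apply: ereal_inf_lbound; exists n => /=.
Qed.

(** * The bounded part of the unit ball and its mean-square projection *)

Definition in_ball (f : R -> R) :=
  [/\ bdd f, forall x, D x -> (0 <= f x)%R & rho (EFin \o f) <= 1].

Lemma in_ball_le (f g : R -> R) : in_ball f -> bdd g ->
  (forall x, D x -> (0 <= g x)%R) -> (forall x, D x -> (g x <= f x)%R) -> in_ball g.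
Proof.
move=> [bf f0 f1] bg g0 gf; split=> //; apply: le_trans f1.
by apply: rho_le; [exact: bdd_Mplus|exact: bdd_Mplus|move=> x /gf; rewrite lee_fin].
Qed.

Lemma in_ball0 : in_ball (fun=> 0%R).
Proof.
have b0 := @bdd_cst R 0%R.
split=> //; rewrite (_ : rho _ = 0) ?lee_fin//.
by apply/rho_eq0; [exact: bdd_Mplus|exact: aeW].
Qed.

Lemma in_ball_convex (f g : R -> R) (t : R) : (0 <= t <= 1)%R ->
  in_ball f -> in_ball g -> in_ball (fun x => (1 - t) * f x + t * g x)%R.
Proof.
move=> /andP[t0 t1] [bf f0 f1] [bg g0 g1].
have s0 : (0 <= 1 - t)%R by rewrite subr_ge0.
have b : bdd (fun x => (1 - t) * f x + t * g x)%R by apply: bddD; exact: bddZ.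
have Mf := bdd_Mplus bf f0; have Mg := bdd_Mplus bg g0.
have Mz (a : R) (h : R -> R) : (0 <= a)%R -> bdd h -> (forall x, D x -> (0 <= h x)%R) ->
    Mplus (fun x => a%:E * (EFin \o h) x).
  move=> a0 bh h0; apply: (@bdd_Mplus _ (fun x => a * h x)%R); first exact: bddZ.
  by move=> x Dx; rewrite mulr_ge0 ?h0.
split=> //; first by move=> x Dx; rewrite addr_ge0// mulr_ge0 ?f0 ?g0.
apply: le_trans (rho_triangle (Mz _ _ s0 bf f0) (Mz _ _ t0 bg g0)) _.
rewrite !rho_homog//.
apply: (@le_trans _ _ ((1 - t)%:E * 1 + t%:E * 1)).
  by apply: leeD; rewrite lee_wpmul2l// lee_fin.
by rewrite !mule1 -EFinD subrK.
Qed.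

(** A minimizing sequence is Cauchy in mean square by convexity, and, chosen fast enough, converges
    almost everywhere. The Fatou property keeps the limit in the ball, and the constraint of staying
    below [F] supplies the domination under which the distances converge. *)
Lemma ball_projection (F : R -> R) : bdd F -> (forall x, D x -> (0 <= F x)%R) ->
  exists f0 : R -> R, [/\ in_ball f0, forall x, D x -> (f0 x <= F x)%R &
    forall h, in_ball h -> (forall x, D x -> (h x <= F x)%R) ->
      (int01 (fun x => (F x - f0 x) * (F x - f0 x)) <=
       int01 (fun x => (F x - h x) * (F x - h x)))%R].
Proof.
move=> bF F0.
pose q h := int01 (fun x => (F x - h x) * (F x - h x))%R.
pose B := [set h | in_ball h /\ forall x, D x -> (h x <= F x)%R].
have bq h : bdd h -> bdd (fun x => (F x - h x) * (F x - h x))%R.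
  by move=> bh; apply: bddM; exact: bddB.
have qlb : lbound (q @` B) 0%R.
  by move=> _ [h _ <-]; apply: int01_ge0 => x _; rewrite -expr2 sqr_ge0.
have hinf : has_inf (q @` B).
  split; last by exists 0%R.
  by exists (q (fun=> 0%R)); exists (fun=> 0%R) => //; split; [exact: in_ball0|].
set d := inf (q @` B).
have dq h : B h -> (d <= q h)%R by move=> Bh; apply: ge_inf; [exists 0%R|exists h].
pose p n : R := (2 ^ n)%:R.
have p0 n : (0 < p n)%R by rewrite ltr0n expn_gt0.
(* The tolerance [4^(-n)] is the decay that [cvg_of_sq_increments] asks for. *)
have /choice[f_ f_P] : forall n, exists h, B h /\ (q h < d + (p n ^+ 2)^-1)%R.
  move=> n; have [|_ [h Bh <-] hq] := @inf_adherent _ (q @` B) ((p n ^+ 2)^-1) _ hinf.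
    by rewrite invr_gt0 exprn_gt0.
  by exists h.
have fB n : B (f_ n) by case: (f_P n).
have fb n : bdd (f_ n) by case: (fB n) => -[].
have f0 n x : D x -> (0 <= f_ n x)%R by case: (fB n) => -[_ + _] _; exact.
have fF n x : D x -> (f_ n x <= F x)%R by case: (fB n) => _; exact.
have fq n : (q (f_ n) < d + (p n ^+ 2)^-1)%R by case: (f_P n).
have half : (0 <= (2^-1 : R) <= 1)%R by rewrite invr_ge0 ler0n invf_le1 ?ler1n.
(* Parallelogram identity around the midpoint, which stays in the ball. *)
have para n m : (int01 (fun x => (f_ n x - f_ m x) * (f_ n x - f_ m x)) <=
    2 * ((p n ^+ 2)^-1 + (p m ^+ 2)^-1))%R.
  pose c x := ((1 - 2^-1) * f_ n x + 2^-1 * f_ m x)%R.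
  have Bc : B c.
    split; first by apply: in_ball_convex => //; [case: (fB n)|case: (fB m)].
    move=> x Dx; have /= := fF n x Dx; have := fF m x Dx; rewrite /c; lra.
  have bc : bdd c by case: Bc => -[].
  have bs : bdd (fun x => (f_ n x - f_ m x) * (f_ n x - f_ m x))%R.
    by apply: bddM; exact: bddB.
  have E : (int01 (fun x => (f_ n x - f_ m x) * (f_ n x - f_ m x)) + 4 * q c =
      2 * (q (f_ n) + q (f_ m)))%R.
    have bqc := bq _ bc; have bqn := bq _ (fb n); have bqm := bq _ (fb m).
    rewrite /q -int01Z// -!int01D//; last exact: bddZ.
    rewrite -int01Z; last exact: bddD.
    by apply: eq_int01 => x _; rewrite /c; field.
  have := dq _ Bc; have := fq n; have := fq m; lra.
have ae_cvg : {ae mu, forall x, D x -> cvgn (f_ ^~ x)}.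
  apply: cvg_of_sq_increments => // n; apply: le_trans (para n.+1 n) _.
  have -> : (p n.+1 = 2 * p n)%R by rewrite /p expnS natrM.
  rewrite -/(p n) exprMn invfM.
  have : (0 <= (p n ^+ 2)^-1)%R by rewrite invr_ge0 exprn_ge0// ltW.
  set e := (p n ^+ 2)^-1%R => e0.
  have : ((2 ^+ 2)^-1 <= 1 :> R)%R by rewrite invf_le1 ?exprn_gt0// exprn_ege1// ler1n.
  nra.
have Mf n : Mplus (EFin \o f_ n) by apply: bdd_Mplus => //; exact: f0.
(* The lower limit is defined and measurable also where the sequence diverges, so the candidate
   minimizer needs no choice on the exceptional null set. *)
have [ML L1] := rho_fatou Mf (fun n => let: conj (And3 _ _ h) _ := fB n in h).
set L := fun x => limn_einf _ in ML L1.
have L0 x : D x -> 0 <= L x by case: ML => _; exact.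
have LF x : D x -> L x <= (F x)%:E.
  move=> Dx; rewrite /L limn_einf_lim.
  apply: lime_le; first exact: is_cvg_einfs.
  apply: nearW => n; apply: (@le_trans _ _ (f_ n x)%:E).
    by apply: ereal_inf_lbound; exists n => /=.
  by rewrite lee_fin fF.
have Lfin x : D x -> L x = (fine (L x))%:E.
  move=> Dx; rewrite fineK// ge0_fin_numE ?L0//.
  by rewrite (le_lt_trans (LF x Dx))// ltry.
pose g x := fine (L x).
have g0 x : D x -> (0 <= g x)%R by move=> Dx; rewrite fine_ge0// L0.
have gF x : D x -> (g x <= F x)%R by move=> Dx; rewrite -lee_fin -Lfin// LF.
have bg : bdd g.
  split; first by apply: measurableT_comp => //; case: ML.
  case: bF => _ [M FM]; exists M => x Dx; rewrite ger0_norm ?g0//.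
  by rewrite (le_trans (gF x Dx))// (le_trans (ler_norm _))// FM.
have gball : in_ball g.
  split=> //; rewrite (_ : rho _ = rho L)//; apply: eq_rho => //.
    exact: bdd_Mplus.
  by move=> x Dx /=; rewrite -Lfin.
have gcvg : {ae mu, forall x, D x -> f_ ^~ x @ \oo --> g x}.
  move: ae_cvg; apply: (@filterS _ _ (ae_filter_ringOfSetsType mu)) => x H Dx; have c := H Dx.
  have : EFin \o (f_ ^~ x) @ \oo --> (limn (f_ ^~ x))%:E.
    by apply: cvg_EFin => //; exact: nearW.
  move=> /cvg_limn_einf_sup[+ _] => e.
  by rewrite /g /L [limn_einf _]e.
exists g; split=> // h hb hF.
rewrite -/(q g) -/(q h); apply: le_trans (dq h _); last by [].
(* As [0 <= f_ n <= F], the squared differences are all dominated by [F^2]. *)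
have sq_le n x : D x -> ((F x - f_ n x) * (F x - f_ n x) <= F x * F x)%R.
  by move=> Dx; have := f0 n x Dx; have := fF n x Dx; nra.
have [] := @dominated_convergence _ _ _ mu D (@measurable_D01 R)
  (fun n x => ((F x - f_ n x) * (F x - f_ n x))%:E)
  (fun x => ((F x - g x) * (F x - g x))%:E)
  (fun x => (F x * F x)%:E).
- by move=> n; apply/measurable_EFinP; case: (bq _ (fb n)).
- by apply/measurable_EFinP; case: (bq _ bg).
- move: gcvg; apply: (@filterS _ _ (ae_filter_ringOfSetsType mu)) => x H Dx; apply: cvg_EFin; first exact: nearW.
  by apply: cvgM; apply: cvgB => //; try exact: cvg_cst; exact: H.
- by apply: bdd_integrable; exact: bddM.
- apply: aeW => x n Dx; rewrite gee0_abs ?lee_fin ?sq_le//.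
  by rewrite -expr2 sqr_ge0.
move=> _ _; rewrite (int01_EFin (bq _ bg)) => H.
rewrite -lee_fin; apply/lee_addgt0Pr => e e0.
apply: (cvge_le _ H).
have [N _ HN] : \forall n \near \oo, ((p n ^+ 2)^-1 < e)%R.
  have [N HN] := ltr_add_invr e0.
  exists N => // n /= Nn; rewrite add0r in HN; apply: le_lt_trans HN.
  rewrite lef_pV2 ?posrE ?exprn_gt0// (@le_trans _ _ (p n))//.
    by rewrite ler_nat (leq_trans _ (ltn_expl n (ltnSn 1)))// ltnS.
  by rewrite expr2 ler_peMl ?(ltW (p0 n))// /p ler1n expn_gt0.
exists N => // n /= Nn; rewrite (int01_EFin (bq _ (fb n))) -EFinD lee_fin.
by rewrite ltW// (lt_trans (fq n))// ltrD2l; exact: HN.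
Qed.

(* The convex combinations of f0 and h, truncated at F, are competitors in the
   minimization, so the first variation of the squared distance at f0 is
   nonnegative. *)
Lemma ball_support (F : R -> R) : bdd F -> (forall x, D x -> (0 <= F x)%R) ->
  exists f0 : R -> R, [/\ in_ball f0, forall x, D x -> (f0 x <= F x)%R &
    forall h, in_ball h ->
      (int01 (fun x => (F x - f0 x) * h x) <= int01 (fun x => (F x - f0 x) * f0 x))%R].
Proof.
move=> bF F0; have [f0 [Bf0 f0F f0min]] := ball_projection bF F0.
exists f0; split=> // h Bh.
have [bf0 f00 _] := Bf0; have [bh h0 _] := Bh.
pose g x := (F x - f0 x)%R; pose u x := (h x - f0 x)%R.
have bg : bdd g by exact: bddB.
have bu : bdd u by exact: bddB.
have bgg : bdd (fun x => g x * g x)%R by exact: bddM.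
have bgu : bdd (fun x => g x * u x)%R by exact: bddM.
have buu : bdd (fun x => u x * u x)%R by exact: bddM.
have var t : (0 < t <= 1)%R ->
    (2 * int01 (fun x => g x * u x) <= t * int01 (fun x => u x * u x))%R.
  move=> /andP[t0 t1].
  pose c x := ((1 - t) * f0 x + t * h x)%R.
  have Bc : in_ball c by apply: in_ball_convex => //; rewrite (ltW t0).
  have [bc c0 _] := Bc.
  pose m x := Num.min (c x) (F x).
  have bm : bdd m by exact: bdd_min.
  have mc x : (m x <= c x)%R by rewrite ge_min lexx.
  have mF x : (m x <= F x)%R by rewrite ge_min lexx orbT.
  have m0 x : D x -> (0 <= m x)%R by move=> Dx; rewrite le_min c0 ?F0.
  have Bm : in_ball m by apply: in_ball_le Bc bm m0 _.
  have le1 := f0min m Bm (fun x _ => mF x).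
  have btu : bdd (fun x => g x - t * u x)%R by apply: bddB => //; exact: bddZ.
  have bsq : bdd (fun x => (g x - t * u x) * (g x - t * u x))%R by exact: bddM.
  (* Truncation at [F] replaces the difference by zero wherever it acts, so it can only shorten the
     distance to [F]. *)
  have le2 : (int01 (fun x => (F x - m x) * (F x - m x)) <=
      int01 (fun x => (g x - t * u x) * (g x - t * u x)))%R.
    apply: le_int01 => //; first by apply: bddM; exact: bddB.
    move=> x Dx.
    have -> : (g x - t * u x = F x - c x)%R by rewrite /g /u /c; ring.
    rewrite /m minEle; case: ifP => // _; rewrite subrr mul0r.
    by rewrite -expr2 sqr_ge0.
  have E : int01 (fun x => (g x - t * u x) * (g x - t * u x))%R =
      (int01 (fun x => g x * g x) - t * (2 * int01 (fun x => g x * u x)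
        - t * int01 (fun x => u x * u x)))%R.
    rewrite -!int01Z// -int01B//; [|exact: bddZ|exact: bddZ].
    rewrite -int01Z; last by apply: bddB; exact: bddZ.
    rewrite -int01B//; last by apply: bddZ; apply: bddB; exact: bddZ.
    by apply: eq_int01 => x _; ring.
  have := le_trans le1 le2; rewrite E -/g lerBrDl -lerBrDr subrr pmulr_rle0//.
  by rewrite subr_le0.
have gu0 : (int01 (fun x => g x * u x) <= 0)%R.
  rewrite leNgt; apply/negP => P.
  set a := int01 _ in var P; set b := int01 (fun x => u x * u x)%R in var.
  have b0 : (0 <= b)%R by apply: int01_ge0 => x _; rewrite -expr2 sqr_ge0.
  have ab0 : (0 < a + b)%R by rewrite ltr_wpDr.
  (* For [a > 0] this [t] is admissible even when [b = 0], and [2 * a <= t * b] would become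
     [2 * (a + b) <= b], which is impossible. *)
  have /var : (0 < a / (a + b) <= 1)%R.
    by rewrite divr_gt0// ler_pdivrMr// mul1r lerDl.
  rewrite mulrAC ler_pdivlMr// => H; nra.
have E : int01 (fun x => g x * u x)%R =
    (int01 (fun x => g x * h x) - int01 (fun x => g x * f0 x))%R.
  rewrite -int01B; [|exact: bddM|exact: bddM].
  by apply: eq_int01 => x _; rewrite /u mulrBr.
by rewrite -subr_le0 -E.
Qed.

(** * Truncation, the associate norm, and recovery of [rho] from it *)

Definition cutoff (f : R -> \bar R) (n : nat) (x : R) : \bar R := mine (f x) n%:R%:E.

Lemma cutoff_cvg (f : R -> \bar R) x : 0 <= f x -> cutoff f ^~ x @ \oo --> f x.
Proof.
rewrite /cutoff; case: (f x) => [r| |] // r0; last first.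
  rewrite (_ : (fun n => _) = (fun n => n%:R%:E)); last first.
    by apply/funext => n; rewrite minEle leye_eq.
  by apply/cvgeryP; exact: cvgr_idn.
apply: cvg_near_cst; exists (Num.truncn r).+1 => // n /= rn.
rewrite minEle lee_fin (le_trans (ltW (truncnS_gt r)))//.
by rewrite ler_nat.
Qed.

Lemma cutoff_homo (f : R -> \bar R) x : {homo (cutoff f ^~ x) : n m / (n <= m)%N >-> n <= m}.
Proof.
move=> n m nm; rewrite le_min ge_min lexx/= (@le_trans _ _ n%:R%:E)//.
  by rewrite ge_min lexx orbT.
by rewrite lee_fin ler_nat.
Qed.

Lemma cutoff_le (f : R -> \bar R) n x : cutoff f n x <= f x.
Proof. by rewrite ge_min lexx. Qed.

Lemma Mplus_cutoff (f : R -> \bar R) n : Mplus f -> Mplus (cutoff f n).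
Proof.
move=> [mf f0]; split; first exact: measurable_mine.
by move=> x Dx; rewrite le_min f0//= lee_fin.
Qed.

Lemma cutoff_EFin (f : R -> \bar R) n : Mplus f -> exists h : R -> R,
  [/\ bdd h, forall x, D x -> (0 <= h x)%R & forall x, D x -> cutoff f n x = (h x)%:E].
Proof.
move=> Mf; have [mt t0] := Mplus_cutoff n Mf.
have tn x : cutoff f n x <= n%:R%:E by rewrite ge_min lexx orbT.
have tE x : D x -> cutoff f n x = (fine (cutoff f n x))%:E.
  by move=> Dx; rewrite fineK// ge0_fin_numE ?t0// (le_lt_trans (tn x))// ltry.
exists (fun x => fine (cutoff f n x)); split=> //.
  split; first exact: measurableT_comp.
  exists n%:R => x Dx; rewrite ger0_norm ?fine_ge0 ?t0//.
  by rewrite -lee_fin -tE.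
by move=> x Dx; rewrite fine_ge0 ?t0.
Qed.

(** The supremum defining the associate norm also runs over unbounded functions; their truncations
    lie in the ball, and monotone convergence transfers the bound. *)
Lemma assoc_norm_le (g : R -> R) (a : R) : bdd g -> (forall x, D x -> (0 <= g x)%R) ->
  (forall h, in_ball h -> (int01 (fun x => g x * h x) <= a)%R) ->
  assoc_norm rho (EFin \o g) <= a%:E.
Proof.
move=> bg g0 ga; apply: ge_ereal_sup => y [f [Mf f1] <-{y}].
have [mf f0] := Mf; have [mg _] := bg.
have mtg n : measurable_fun D (fun x => cutoff f n x * (g x)%:E).
  by apply: emeasurable_funM; [case: (Mplus_cutoff n Mf)|exact/measurable_EFinP].
have cv := @cvg_monotone_convergence _ _ _ mu D (@measurable_D01 R)
  (fun n x => cutoff f n x * (g x)%:E) mtg.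
have lim_eq : \int[mu]_(x in D) limn (fun n => cutoff f n x * (g x)%:E) =
    \int[mu]_(x in D) (f x * (EFin \o g) x).
  apply: eq_integral => x /set_mem Dx; apply/cvg_lim => //.
  by apply: cvgeZr => //; apply: cutoff_cvg; exact: f0.
rewrite lim_eq in cv.
have {}cv : \int[mu]_(x in D) (cutoff f n x * (g x)%:E) @[n --> \oo] -->
    \int[mu]_(x in D) (f x * (EFin \o g) x).
  apply: cv.
  - move=> n x Dx; rewrite mule_ge0 ?lee_fin ?g0//.
    by case: (Mplus_cutoff n Mf) => _; exact.
  - move=> x Dx n m nm; rewrite lee_wpmul2r ?lee_fin ?g0//.
    exact: cutoff_homo.
apply: (cvge_le _ cv); apply: nearW => n.
have [h [bh h0 hE]] := cutoff_EFin n Mf.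
have Bh : in_ball h.
  split=> //; apply: le_trans f1; apply: rho_le => //; first exact: bdd_Mplus.
  by move=> x Dx; rewrite /= -hE// cutoff_le.
rewrite (_ : \int[mu]_(x in D) _ = \int[mu]_(x in D) (g x * h x)%:E); last first.
  by apply: eq_integral => x /set_mem Dx; rewrite hE// muleC.
by rewrite int01_EFin ?lee_fin ?ga//; exact: bddM.
Qed.

(** Monotone continuity of [rho] reduces to truncations of [F]. If one had norm above [K], the gap
    between its rescaling and the projection of that rescaling would be a test function, and testing
    forces the gap to vanish almost everywhere. *)
Lemma lorentz_luxemburg (F : R -> \bar R) (K : R) : Mplus F -> (0 <= K)%R ->
  (forall g, Mplus g -> \int[mu]_(x in D) (F x * g x) <= K%:E * assoc_norm rho g) ->
  rho F <= K%:E.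
Proof.
move=> MF K0 FK.
have [mF F0] := MF.
have cv := rho_cvg (fun n => Mplus_cutoff n MF) MF (fun x _ => @cutoff_homo F x)
  (fun x Dx => cutoff_cvg (F0 x Dx)).
apply: (cvge_le _ cv); apply: nearW => n.
have [k [bk k0 kE]] := cutoff_EFin n MF.
have Mk := bdd_Mplus bk k0.
rewrite (eq_rho (Mplus_cutoff n MF) Mk kE) leNgt; apply/negP => Kk.
(* A strict intermediate value is positive and finite, so division by [L] is legitimate even if
   [K = 0] or the norm is infinite, and [k / L] has norm above one. *)
have [L [KL Lk]] : exists L : R, (K < L)%R /\ L%:E < rho (EFin \o k).
  move: Kk; case: (rho _) => [r|_|//].
    rewrite lte_fin => Kr; exists ((K + r) / 2)%R; rewrite lte_fin.
    by split; lra.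
  by exists (K + 1)%R; rewrite ltry; split=> //; rewrite ltrDl.
have L0 : (0 < L)%R by exact: le_lt_trans KL.
pose k' x := (L^-1 * k x)%R.
have bk' : bdd k' by exact: bddZ.
have k'0 x : D x -> (0 <= k' x)%R.
  by move=> Dx; rewrite mulr_ge0 ?k0// invr_ge0 ltW.
have [f0 [Bf0 f0k sup]] := ball_support bk' k'0.
have [bf0 f00 f01] := Bf0.
pose g x := (k' x - f0 x)%R.
have bg : bdd g by exact: bddB.
have g0 x : D x -> (0 <= g x)%R by move=> Dx; rewrite subr_ge0 f0k.
have Mg := bdd_Mplus bg g0.
set a := int01 (fun x => g x * f0 x)%R in sup.
have a0 : (0 <= a)%R by apply: int01_ge0 => x Dx; rewrite mulr_ge0 ?g0 ?f00.
have ga := assoc_norm_le bg g0 sup.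
have bkg : bdd (fun x => g x * k' x)%R by exact: bddM.
have bff : bdd (fun x => g x * f0 x)%R by exact: bddM.
(* The hypothesis is tested with [g], whose associate norm is at most [a] by the supporting property
   of the projection [f0]. *)
have le1 : (L * int01 (fun x => g x * k' x) <= K * a)%R.
  rewrite -lee_fin -int01Z// -int01_EFin; last exact: bddZ.
  apply: le_trans (_ : K%:E * assoc_norm rho (EFin \o g) <= _); last first.
    by rewrite EFinM lee_wpmul2l.
  apply: le_trans (FK _ Mg); apply: ge0_le_integral => //.
  - move=> x Dx; rewrite lee_fin mulr_ge0 ?(ltW L0)// mulr_ge0 ?g0 ?k'0//.
  - by apply/measurable_EFinP; case: (bddZ L bkg).
  - by apply: emeasurable_funM => //; case: Mg.
  - move=> x Dx; rewrite /k' mulrCA (mulrA L) mulfV ?gt_eqF// mul1r mulrC EFinM.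
    rewrite lee_wpmul2r ?lee_fin ?g0//.
    by rewrite -kE// cutoff_le.
have le2 : (int01 (fun x => g x * k' x) <= a)%R.
  rewrite -(ler_pM2l L0) (le_trans le1)// ler_wpM2r//.
  exact: ltW.
(* As [g = k' - f0], the integral of [g^2] is that of [g * k'] minus [a], hence nonpositive by
   [le2]. Thus [k'] agrees with [f0] almost everywhere and has norm at most one, against the choice
   of [L]. *)
have gg0 : int01 (fun x => g x * g x)%R = 0%R.
  apply/eqP; rewrite eq_le int01_ge0 ?andbT; last by move=> x _; rewrite -expr2 sqr_ge0.
  rewrite (@eq_int01 _ _ (fun x => g x * k' x - g x * f0 x)%R); last first.
    by move=> x _; rewrite -mulrBr.
  by rewrite int01B// subr_le0.
have ae0 : {ae mu, forall x, D x -> g x = 0%R}.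
  have mgg : measurable_fun D (fun x => (g x * g x)%:E).
    by apply/measurable_EFinP; case: (bddM bg bg).
  have := proj1 (ae_eq_integral_abs mu (@measurable_D01 R) mgg).
  under eq_integral do rewrite gee0_abs ?lee_fin -?expr2 ?sqr_ge0//.
  under eq_integral do rewrite expr2.
  rewrite int01_EFin; last exact: bddM.
  rewrite gg0 => /(_ erefl).
  apply: (@filterS _ _ (ae_filter_ringOfSetsType mu)) => x H Dx.
  have /eqP := H Dx; rewrite /= eqe mulf_eq0 orbb => /eqP//.
have k'1 : rho (EFin \o k') <= 1.
  apply: le_trans f01; apply: rho_ae_le; [exact: bdd_Mplus|exact: bdd_Mplus|].
  move: ae0; apply: (@filterS _ _ (ae_filter_ringOfSetsType mu)) => x H Dx.
  by have /eqP := H Dx; rewrite subr_eq0 /= => /eqP ->.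
have : rho (EFin \o k') = (L^-1)%:E * rho (EFin \o k).
  by rewrite -rho_homog// invr_ge0 ltW.
move=> E; rewrite E in k'1.
have : L%:E * ((L^-1)%:E * rho (EFin \o k)) <= L%:E * 1.
  by rewrite lee_wpmul2l// lee_fin ltW.
have LL : L%:E * (L^-1)%:E = 1 :> \bar R by rewrite -EFinM mulfV// gt_eqF.
by rewrite muleA LL mul1e mule1 leNgt Lk.
Qed.

(** A function of positive finite norm, divided by that norm, competes in the supremum defining the
    associate norm. If the norm is zero, [f] vanishes almost everywhere and both sides are zero,
    with the convention [0 * +oo = 0]. *)
Lemma hoelder_assoc (f g : R -> \bar R) : Mplus f -> Mplus g -> rho f < +oo ->
  \int[mu]_(x in D) (f x * g x) <= rho f * assoc_norm rho g.
Proof.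
move=> Mf Mg foo.
have [mf f0] := Mf; have [mg g0] := Mg.
have [r fr] : exists r : R, rho f = r%:E.
  by exists (fine (rho f)); rewrite fineK// ge0_fin_numE// rho_ge0.
have r0 : (0 <= r)%R by rewrite -lee_fin -fr rho_ge0.
rewrite fr; move: r0; rewrite le_eqVlt => /orP[/eqP r0|r0].
  have /(rho_eq0 Mf) f_eq0 : rho f = 0 by rewrite fr -r0.
  rewrite -r0 mul0e (_ : \int[mu]_(x in D) _ = \int[mu]_(x in D) cst 0 x); last first.
    apply: ge0_ae_eq_integral => //.
    - exact: emeasurable_funM.
    - by move=> x Dx; rewrite mule_ge0 ?f0 ?g0.
    - move: f_eq0; apply: (@filterS _ _ (ae_filter_ringOfSetsType mu)) => x H Dx.
      by rewrite H// mul0e.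
  by rewrite integral0.
have Mrf : Mplus (fun x => (r^-1)%:E * f x).
  split; first by apply: emeasurable_funM.
  by move=> x Dx; rewrite mule_ge0 ?f0// lee_fin invr_ge0 ltW.
have -> : \int[mu]_(x in D) (f x * g x) =
    r%:E * \int[mu]_(x in D) ((r^-1)%:E * f x * g x).
  rewrite -ge0_integralZl//; last 3 first.
  - by apply: emeasurable_funM => //; case: Mrf.
  - by move=> x Dx; rewrite mule_ge0 ?g0//; case: Mrf => _; exact.
  - by rewrite lee_fin ltW.
  apply: eq_integral => x _; rewrite !muleA.
  by have -> : r%:E * (r^-1)%:E = 1 :> \bar R; rewrite ?mul1e// -EFinM mulfV// gt_eqF.
rewrite lee_wpmul2l ?lee_fin ?(ltW r0)//; apply: ereal_sup_ubound.
exists (fun x => (r^-1)%:E * f x) => //; split=> //.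
rewrite rho_homog ?invr_ge0 ?(ltW r0)// fr.
by have -> : (r^-1)%:E * r%:E = 1 :> \bar R; rewrite // -EFinM mulVf// gt_eqF.
Qed.

End Duality.

(** * Equivalence of the supremum with the value at the rearrangement *)

Unset Implicit Arguments.

Theorem theorem4p14 (R : realType) (I : R -> R) (rho : (R -> \bar R) -> \bar R) :
  quasiconcave I ->
  (exists C : R, (0 < C)%R /\ forall t, D01 t ->
     \int[@lebesgue_measure R]_(s in `]0%R, t[) ((I s / s)%:E) <= C%:E * (I t)%:E) ->
  ri_norm rho ->
  rho (H_op I (fun=> 1)) < +oo ->
  (exists C : R, (0 < C)%R /\ forall g, Mplus g ->
     assoc_norm rho (T_op I g) <= C%:E * assoc_norm rho g) ->
  exists c1 c2 : R, (0 < c1)%R /\ (0 < c2)%R /\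
    forall f, Mplus f ->
      c1%:E * rho (H_op I (fstar f))
        <= ereal_sup [set rho (H_op I h) | h in equimeas f] /\
      ereal_sup [set rho (H_op I h) | h in equimeas f]
        <= c2%:E * rho (H_op I (fstar f)).
Proof.
move=> qI [C [C0 intI]] rho_ri _ [C' [C'0 TC']].
have c2_gt0 : (0 < (1 + C) * C')%R by rewrite mulr_gt0// addr_gt0.
(* The factor [1 + C] comes from [H_op_duality] and [C'] from the boundedness of [T_I] on the
   associate space; the lower constant is [1] because [f^*] is itself a competitor. *)
exists 1%R, ((1 + C) * C')%R; split=> //; split=> // f Mf; split.
  by rewrite mul1e; apply: ereal_sup_ubound; exists (fstar f) => //; exact: equimeas_fstar.
apply: ge_ereal_sup => y [h [Mh hf] <-{y}].
have MHf := Mplus_H_op qI (Mplus_fstar f).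
have MHh := Mplus_H_op qI Mh.
have r0 := rho_ge0 rho_ri MHf.
(* An infinite right-hand side makes the bound trivial; otherwise [hoelder_assoc] applies to
   [H_I f^*]. *)
have [roo|roo] := ltP (rho (H_op I (fstar f))) +oo; last first.
  move: roo; rewrite leye_eq => /eqP ->.
  by rewrite gt0_muley ?leey// lte_fin.
have [r rE] : exists r : R, rho (H_op I (fstar f)) = r%:E.
  by exists (fine (rho (H_op I (fstar f)))); rewrite fineK// ge0_fin_numE.
rewrite rE -EFinM; apply: (lorentz_luxemburg rho_ri) => //.
  by rewrite mulr_ge0 ?(ltW c2_gt0)// -lee_fin -rE.
move=> g Mg.
apply: le_trans (H_op_duality qI C0 intI Mg Mh) _.
have -> : \int[lebesgue_measure]_(t in @D01 R) (H_op I (fstar h) t * T_op I g t) =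
    \int[lebesgue_measure]_(t in @D01 R) (H_op I (fstar f) t * T_op I g t).
  (* Equimeasurability gives [h^* = f^*] on [D] only, which suffices because [H_I] at [t] integrates
     over []t, 1[]. *)
  apply: eq_integral => t /set_mem Dt.
  by rewrite (eq_H_op I Dt hf).
rewrite -mulrA EFinM -muleA lee_wpmul2l//.
  by rewrite lee_fin addr_ge0// ltW.
apply: le_trans (hoelder_assoc rho_ri MHf (Mplus_T_op qI g) roo) _.
rewrite rE mulrC EFinM -muleA lee_wpmul2l ?TC'//.
by rewrite -rE.
Qed.
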